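(* There are no $(4,2;+1)$-digraphs; that is, there is no $2$-geodetic digraph with minimum out-degree $4$ and order $1+4+4^2+1=22$.
   Context: Digraphs are finite and without multiple arcs. A digraph $G$ is $k$-geodetic if for any (not necessarily distinct) vertices $u,v$ there is at most one directed walk from $u$ to $v$ of length at most $k$ (walks of length $0$ count, so there are no directed cycles of length at most $k$). A $(d,k;+1)$-digraph is a $k$-geodetic digraph with minimum out-degree $d$ and order $M(d,k)+1$, where $M(d,k)=1+d+d^2+\dots+d^k$. It is known that every $(d,k;+1)$-digraph with $d,k\ge 2$ is diregular (all in-degrees and out-degrees equal $d$). *)

(* Defs.v *)
From mathcomp Require Import all_boot.

Set Implicit Arguments.
Unset Strict Implicit.
Unset Printing Implicit Defensive.

(* A finite digraph without multiple arcs is an arbitrary relation [e : rel T]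
   on a finite vertex type [T]; loops are not excluded a priori. *)

Definition outdeg (T : finType) (e : rel T) (u : T) : nat :=
  #|[set v | e u v]|.

Definition min_outdeg_is (T : finType) (e : rel T) (d : nat) : Prop :=
  (forall u, d <= outdeg e u) /\ (exists u, outdeg e u = d).

(* A walk from [u] to [v] is given by the sequence [p] of its vertices after
   [u], so its length is [size p]; the empty sequence is the walk of length 0
   from [u] to itself. *)
Definition walk (T : finType) (e : rel T) (u v : T) (p : seq T) : Prop :=
  path e u p /\ last u p = v.

Definition geodetic (T : finType) (e : rel T) (k : nat) : Prop :=
  forall (u v : T) (p q : seq T),
    walk e u v p -> walk e u v q -> size p <= k -> size q <= k -> p = q.

Definition moore_bound (d k : nat) : nat := \sum_(i < k.+1) d ^ i.

Definition excess_one_digraph (d k : nat) (T : finType) (e : rel T) : Prop :=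
  [/\ geodetic e k, min_outdeg_is e d & #|T| = moore_bound d k + 1].

(* Main.v *)
(* Counting walks, such a digraph has all out-degrees 4 and every vertex [u] has a
   unique outlier [o u] at distance more than 2, i.e. its adjacency matrix [A]
   satisfies [1 + A + A^2 = J - P] with [P] the matrix of [o].

   Spectral input: if [A] has a quotient matrix [Q] of size [m] along a partition
   into blocks, with [Q + Q^2 + c] constant on columns ([c >= 1]), then the
   eigenvalues of [Q] have real part 4 or -1/2, so [2 tr Q + m] is a multiple
   of 9.

   If some in-degree is not 4, then there are just two outliers, with the same
   out-neighbours; merging them leaves [m = 21], [tr Q = 0], impossible.
   Otherwise [o] is an automorphism, without fixed vertices.  The vertices fixed by
   a power of [o] span a [d]-regular subdigraph of order [d^2 + d + 2].  For [p] a
   prime factor of the order of [o] and [g] a power of [o] of order [p], the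
   out-neighbours of a fixed vertex of [g] that are not fixed split into orbits of
   length [p], so [p] divides [4 - d], and the [p]-part of the order of [o] divides
   the number of vertices moved by [g].  This leaves only few cycle types of [o],
   which are refuted by the spectral input for the quotient by the orbits of [o]
   ([c = 2]): an orbit contains at most one out-neighbour of each of its vertices,
   and none if its length is 2, so that [tr Q] is small. *)

Require Import Defs.
From mathcomp Require Import all_boot.
From mathcomp Require Import all_fingroup all_algebra cyclic algC zify ring.

Set Implicit Arguments.
Unset Strict Implicit.
Unset Printing Implicit Defensive.

(** * Traces of quotient matrices *)

Section Spectrum.
Import GRing.Theory Num.Theory.
Local Open Scope ring_scope.

(** [s = 2 z + 1] has the negative square [1 - 4 c], so it is purely imaginary. *)
Lemma conj_add_of_quadratic (c : nat) (z : algC) :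
  (0 < c)%N -> z + z ^+ 2 + c%:R = 0 -> z + z^* = -1.
Proof.
move=> c_gt0 hz; pose s := z *+ 2 + 1.
have s2E : s ^+ 2 = - (4 * c - 1)%N%:R.
  rewrite natrB; last by lia.
  have cE : c%:R = - (z + z ^+ 2) :> algC by apply/eqP; rewrite -addr_eq0 addrC hz.
  by rewrite natrM cE /s; ring.
have sconj : s^* = - s.
  apply/eqP; have /eqP : s^* ^+ 2 = s ^+ 2.
    by rewrite -rmorphXn /= s2E rmorphN /= rmorph_nat.
  rewrite eqf_sqr => /orP[/eqP/CrealP s_real | //].
  have := real_exprn_even_ge0 s_real (erefl (~~ odd 2)).
  by rewrite s2E oppr_ge0 lern0; lia.
have : (z + z^* + 1) *+ 2 = 0.
  move: sconj; rewrite /s rmorphD rmorphMn /= rmorph1 => E.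
  by transitivity (s + (z^* *+ 2 + 1)); [rewrite /s; ring | rewrite E subrr].
by move/eqP; rewrite mulrn_eq0 /= addr_eq0 => /eqP.
Qed.

(* [Q + Q^2 + c] has constant columns, so it vanishes on the vectors of zero sum;
   every eigenvalue of [Q] is therefore [d] or a root of [x^2 + x + c], whose
   real part is [-1/2]. *)
Lemma trace_of_quotient (I : finType) (Q : I -> I -> nat) (w : I -> nat)
    (d c : nat) :
  (0 < c)%N -> (forall i, (\sum_j Q i j)%N = d) ->
  (forall i j, (c * (i == j) + Q i j + \sum_k Q i k * Q k j)%N = w j) ->
  exists k, (2 * (\sum_i Q i i) + #|I| = (2 * d + 1) * k)%N.
Proof.
move=> c_gt0 rowQ quadQ; have [I0|I_gt0] := posnP #|I|.
  exists 0%N; rewrite muln0 I0 big1 // => i; by have := fintype0 i I0.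
pose M : 'M[algC]_#|I| := \matrix_(i, j) (Q (enum_val i) (enum_val j))%:R.
have sumI (F : I -> nat) : \sum_(i < #|I|) (F (enum_val i))%:R = (\sum_i F i)%N%:R :> algC.
  by rewrite natr_sum [RHS](reindex (@enum_val I I)) //; apply: onW_bij; apply: enum_val_bij.
have trM : \tr M = (\sum_i Q i i)%N%:R.
  by rewrite -sumI; apply: eq_bigr => i _; rewrite mxE.
have root_cases z : root (char_poly M) z -> z + z^* = (2 * d)%N%:R \/ z + z^* = -1.
  rewrite -eigenvalue_root_char => /eigenvalueP[v vM v_neq0].
  have vM1 : z * (\sum_i v 0 i) = d%:R * (\sum_i v 0 i).
    transitivity (\sum_j (v *m M) 0 j).
      by rewrite vM mulr_sumr; apply: eq_bigr => j _; rewrite mxE.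
    under eq_bigr do rewrite mxE.
    rewrite exchange_big mulr_sumr; apply: eq_bigr => i _ /=.
    rewrite -mulr_sumr mulrC; congr (_ * _).
    under eq_bigr do rewrite mxE.
    by rewrite (sumI (Q (enum_val i))) rowQ.
  have [v1_eq0|v1_neq0] := eqVneq (\sum_i v 0 i) 0; last first.
    left; have -> : z = d%:R by apply: (mulIf v1_neq0).
    by rewrite rmorph_nat -natrD; congr (_%:R); lia.
  right; apply: (conj_add_of_quadratic c_gt0).
  pose W : 'M[algC]_#|I| := \matrix_(i, j) (w (enum_val j))%:R.
  have MM : c%:R%:M + M + M *m M = W.
    apply/matrixP => i j; rewrite !mxE -(quadQ (enum_val i)) !natrD natrM.
    congr (_ + _ + _).
      by rewrite (inj_eq enum_val_inj) mulr_natr.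
    rewrite -(sumI (fun k => Q (enum_val i) k * Q k (enum_val j))%N).
    by apply: eq_bigr => k _; rewrite !mxE natrM.
  have vw0 : v *m W = 0.
    apply/rowP => j; rewrite !mxE; under eq_bigr do rewrite mxE.
    by rewrite -mulr_suml v1_eq0 mul0r.
  have E : (z + z ^+ 2 + c%:R) *: v = 0.
    rewrite -vw0 -MM !mulmxDr mulmxA mul_mx_scalar vM -scalemxAl vM.
    by rewrite !scalerDl expr2 -scalerA addrC addrA.
  by move/eqP: E; rewrite scaler_eq0 (negPf v_neq0) orbF => /eqP.
have [r rE] := closed_field_poly_normal (char_poly M).
rewrite (monicP (char_poly_monic M)) scale1r in rE.
have szr : size r = #|I|.
  by apply: succn_inj; rewrite -(size_char_poly M) rE size_prod_XsubC.
have tr_r : \tr M = \sum_(z <- r) z.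
  apply: oppr_inj; rewrite -char_poly_trace // rE -szr coefPn_prod_XsubC //.
  by rewrite szr -lt0n.
have rroot z : z \in r -> root (char_poly M) z by rewrite rE root_prod_XsubC.
(* Each root adds [z + z^* + 1], which is [2 d + 1] or 0. The trace, being an integer, is also the
   sum of the conjugates. *)
have [k rk] : exists k, \sum_(z <- r) (z + z^*) + (size r)%:R = ((2 * d + 1) * k)%N%:R.
  have : forall z, z \in r -> z + z^* = (2 * d)%N%:R \/ z + z^* = -1.
    by move=> z /rroot; apply: root_cases.
  elim: (r) => [|z s IHs] hs; first by exists 0%N; rewrite big_nil muln0 addr0.
  have [|k hk] := IHs; first by move=> y ys; apply: hs; rewrite inE ys orbT.
  rewrite big_cons /= -natr1 [X in X + _]addrC addrACA hk.
  case: (hs z (mem_head _ _)) => ->.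
    by exists k.+1; rewrite natr1 -natrD; congr (_%:R); lia.
  by exists k; rewrite addNr addr0.
exists k; apply/eqP; rewrite -(eqr_nat algC) -rk natrD szr; apply/eqP.
congr (_ + _); rewrite big_split /= -rmorph_sum -tr_r trM rmorph_nat -natrD.
by congr (_%:R); lia.
Qed.

End Spectrum.

(** * Orbits of a permutation *)

Section PermOrbits.
Variables (T : finType) (g : {perm T}).

Lemma permX_fixE n x : ((g ^+ n)%g x == x) = (#|porbit g x| %| n).
Proof.
pose l := #|porbit g x|; have gl : iter l g x = x by apply: iter_porbit.
have gmul k : iter (k * l) g x = x.
  by elim: k => // k IHk; rewrite mulSn iterD IHk gl.
have l_gt0 : 0 < l by rewrite lt0n card_porbit_neq0.
rewrite permX {1}(divn_eq n l) addnC iterD gmul.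
apply/eqP/idP => [gr|/eqP ->] //; apply: contraT; rewrite -lt0n => r_gt0.
have := uniq_traject_porbit g x; rewrite -/l => /(nth_uniq x).
rewrite size_traject => /(_ (n %% l) 0); rewrite ltn_mod l_gt0 => /(_ isT isT).
by rewrite !nth_traject ?ltn_mod //= gr eqxx => /esym/eqP r0; rewrite r0 in r_gt0.
Qed.

Lemma dvdn_porbit_order x : #|porbit g x| %| #[g]%g.
Proof. by rewrite porbitE dvdn_orbit. Qed.

Lemma dvdn_card_of_porbits (W : {set T}) m :
  (forall x, x \in W -> g x \in W) ->
  (forall x, x \in W -> m %| #|porbit g x|) -> m %| #|W|.
Proof.
move=> gW mW; have actW : [acts <[g]>%g, on W | 'P]%act.
  rewrite cycle_subG !inE; apply/subsetP => x xW.
  by rewrite inE; apply: gW.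
rewrite -(acts_sum_card_orbit actW); apply: dvdn_sum => _ /imsetP[x xW ->].
by rewrite -porbitE; apply: mW.
Qed.

(** If [p] divided the quotient [t] of the order by the orbit length, that length would divide [#[g]
    %/ p]. So the length contains the whole [p]-part. *)
Lemma pfactor_dvd_porbit p x : prime p -> p %| #[g]%g ->
  (g ^+ (#[g] %/ p))%g x != x -> p ^ logn p #[g]%g %| #|porbit g x|.
Proof.
move=> p_pr p_dvd; rewrite permX_fixE => l_ndvd.
have /dvdnP[t NE] := dvdn_porbit_order x.
have cpt : coprime p t.
  rewrite prime_coprime //; apply: contra l_ndvd => /dvdnP[t' tE].
  by rewrite NE tE mulnAC mulnK ?prime_gt0 // dvdn_mull.
rewrite -(Gauss_dvdr _ (coprimeXl (logn p #[g]%g) cpt)) -NE.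
exact: pfactor_dvdnn.
Qed.

End PermOrbits.

(** * Walk counts, outliers and diregularity *)

Section ExcessOne.
Variables (T : finType) (e : rel T).
Hypothesis geo : geodetic e 2.
Hypothesis outdeg_ge4 : forall u, 4 <= outdeg e u.
Hypothesis cardT22 : #|T| = 22.

Definition nwalks (u v : T) : nat := (u == v) + e u v + \sum_w e u w * e w v.

(* The default is never used: by [nwalks_outlier] the vertex picked exists and is
   unique. *)
Definition outlier (u : T) : T := odflt u [pick v | nwalks u v == 0].

Lemma loopless u : e u u = false.
Proof.
apply/negP => euu; suff: [::] = [:: u] by [].
by apply: (@geo u u) => //; split; rewrite //= euu.
Qed.

Lemma no_digon u v : e u v -> e v u = false.
Proof.
move=> euv; apply/negP => evu; suff: [::] = [:: v; u] by [].
by apply: (@geo u u) => //; split; rewrite //= euv evu.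
Qed.

Lemma no_shortcut u v w : e u w -> e w v -> e u v = false.
Proof.
move=> euw ewv; apply/negP => euv; suff: [:: v] = [:: w; v] by [].
by apply: (@geo u v) => //; split; rewrite //= ?euv // euw ewv.
Qed.

Lemma middle_unique u v w w' : e u w -> e w v -> e u w' -> e w' v -> w = w'.
Proof.
move=> euw ewv euw' ew'v; suff: [:: w; v] = [:: w'; v] by case.
by apply: (@geo u v) => //; split; rewrite //= ?euw ?ewv // euw' ew'v.
Qed.

Lemma sum_delta (v : T) (F : T -> nat) : \sum_w (v == w) * F w = F v.
Proof.
rewrite (bigD1 v) //= eqxx mul1n big1 ?addn0 // => w /negPf.
by rewrite eq_sym => ->.
Qed.

Lemma nwalks_le1 u v : nwalks u v <= 1.
Proof.
rewrite /nwalks; have [w /andP[euw ewv]|no2] := pickP [pred w | e u w && e w v].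
  rewrite (no_shortcut euw ewv) (bigD1 w) //= euw ewv big1 => [|w' w'w].
    suff /negPf-> : u != v by [].
    by apply/eqP => uv; rewrite -uv (no_digon euw) in ewv.
  case euw': (e u w') => //; case ew'v: (e w' v) => //.
  by rewrite (middle_unique euw' ew'v euw ewv) eqxx in w'w.
rewrite big1 => [|w _]; last by have /= := no2 w; case: (e u w); case: (e w v).
by case: eqP => [->|_]; rewrite ?loopless //; case: (e u v).
Qed.

Lemma card_sum (P : pred T) : #|[set v | P v]| = \sum_v P v.
Proof.
rewrite cardsE -sum1_card big_mkcond /=.
by apply: eq_bigr => v _; rewrite unfold_in; case: (P v).
Qed.

Lemma sum_nwalks u :
  \sum_v nwalks u v = 1 + \sum_v e u v + \sum_w e u w * \sum_v e w v.
Proof.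
rewrite /nwalks !big_split /=; congr (_ + _ + _).
  by rewrite -[RHS](sum_delta u (fun=> 1)); apply: eq_bigr => v; rewrite muln1.
by rewrite exchange_big; apply: eq_bigr => w _; rewrite big_distrr.
Qed.

(** With out-degree [m], at least [1 + m + 4 m] vertices are reached from [u], too many if
    [m >= 5]. *)
Lemma outdeg4 u : \sum_v e u v = 4.
Proof.
apply/eqP; rewrite eqn_leq -card_sum [4 <= _]outdeg_ge4 andbT card_sum.
have : \sum_v nwalks u v <= 22.
  by rewrite -cardT22 -sum1_card; apply: leq_sum => v _; apply: nwalks_le1.
rewrite sum_nwalks.
have : \sum_w e u w * 4 <= \sum_w e u w * \sum_v e w v.
  by apply: leq_sum => w _; rewrite leq_mul2l -card_sum outdeg_ge4 orbT.
by rewrite -big_distrl /=; lia.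
Qed.

(** The walks from [u] reach [1 + 4 + 16 = 21] of the 22 vertices, once each. *)
Lemma nwalks_outlier u v : nwalks u v + (outlier u == v) = 1.
Proof.
have /eqP/cards1P[x x_def] : #|[set v | nwalks u v == 0]| = 1.
  have : \sum_v (nwalks u v + (nwalks u v == 0)) = 22.
    rewrite -cardT22 -sum1_card; apply: eq_bigr => w _.
    by have := nwalks_le1 u w; case: (nwalks u w) => [|[]].
  rewrite big_split /= sum_nwalks outdeg4.
  under eq_bigr do rewrite outdeg4.
  by rewrite -big_distrl /= outdeg4 card_sum; lia.
have xP w : (nwalks u w == 0) = (w == x).
  by have /setP/(_ w) := x_def; rewrite !inE.
have -> : outlier u = x.
  rewrite /outlier; case: pickP => [w|/(_ x)]; first by rewrite xP => /eqP.
  by rewrite xP eqxx.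
by have := nwalks_le1 u v; rewrite [x == v]eq_sym -xP; case: (nwalks u v) => [|[]].
Qed.

(* For the adjacency matrix [A] of the subdigraph on [H], this equates the
   [(u, v)] entries of [A (1 + A + A^2)] and [(1 + A + A^2) A]. *)
Lemma degree_balance (H : {set T}) u v :
    (forall x y z, x \in H -> z \in H -> e x y -> e y z -> y \in H) ->
    u \in H -> v \in H -> outlier u \in H ->
  \sum_(w in H) e w v + \sum_(w in H) e u w * (outlier w == v)
    = \sum_(w in H) e u w + e (outlier u) v.
Proof.
move=> Hconv uH vH ouH.
have sumH x (F : T -> nat) : x \in H -> \sum_(w in H) (x == w) * F w = F x.
  move=> xH; rewrite -[RHS](sum_delta x) big_mkcond; apply: eq_bigr => w _.
  by case: ifP => // wH; case: eqP => // xw; rewrite -xw xH in wH.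
(* By convexity, walks of length 2 between vertices of [H] stay in [H]. *)
have mid x y : x \in H -> y \in H ->
    \sum_z e x z * e z y = \sum_(z in H) e x z * e z y.
  move=> xH yH; rewrite [RHS]big_mkcond; apply: eq_bigr => z _.
  case: ifP => // /negP zH; case exz: (e x z) => //; case ezy: (e z y) => //.
  by case: zH; apply: Hconv exz ezy.
have out_split : \sum_(w in H) e u w =
    \sum_(w in H) e u w * nwalks w v + \sum_(w in H) e u w * (outlier w == v).
  by rewrite -big_split /=; apply: eq_bigr => w _; rewrite -mulnDr nwalks_outlier muln1.
have in_split : \sum_(w in H) e w v =
    \sum_(w in H) nwalks u w * e w v + e (outlier u) v.
  rewrite -(sumH (outlier u) (fun w => e w v : nat)) // -big_split /=.
  by apply: eq_bigr => w _; rewrite -mulnDl nwalks_outlier mul1n.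
suff commute : \sum_(w in H) e u w * nwalks w v = \sum_(w in H) nwalks u w * e w v.
  by rewrite out_split in_split commute addnAC.
rewrite /nwalks.
under eq_bigr => w wH do rewrite (mid w v wH vH) !mulnDr.
under [RHS]eq_bigr => w wH do rewrite (mid u w uH wH) !mulnDl.
rewrite !big_split /= -!addnA addnCA (sumH u (fun w => e w v : nat)) //.
have -> : \sum_(w in H) e u w * (w == v) = e u v.
  rewrite -(sumH v (fun w => e u w : nat)) //; apply: eq_bigr => w _.
  by rewrite mulnC eq_sym.
rewrite addnCA; congr (_ + (_ + _)).
under eq_bigr => w wH do rewrite big_distrr.
rewrite exchange_big; apply: eq_bigr => w wH; rewrite big_distrl /=.
by apply: eq_bigr => z zH; rewrite mulnA.
Qed.

(* Summing [nwalks_outlier] over blocks, the quotient matrix [Q] of [e] along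
   the retraction [f] satisfies [Q + Q^2 + 1 = J - P], where [P] records the
   blocks of the outliers. *)
Lemma quotient_trace (f : T -> T) (c : nat) (b : T -> nat) :
    0 < c -> (forall u, f (f u) = f u) ->
    (forall u j, \sum_v e (f u) v * (f v == j) = \sum_v e u v * (f v == j)) ->
    (forall i j, f i = i -> f j = j ->
       c * (i == j) + b j = (i == j) + (f (outlier i) == j)) ->
  exists k, 2 * (\sum_(i in [set i | f i == i]) \sum_v e i v * (f v == i))
            + #|[set i | f i == i]| = 9 * k.
Proof.
move=> c_gt0 ff equit outl; set S := [set i | f i == i].
pose Q i j := \sum_v e i v * (f v == j).
have fS v : f v \in S by rewrite inE ff.
have block_sum v (F : T -> nat) : \sum_(k in S) (f v == k) * F k = F (f v).
  rewrite -[RHS](sum_delta (f v)) big_mkcond; apply: eq_bigr => k _.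
  by case: ifP => // kS; case: eqP => // fvk; rewrite -fvk fS in kS.
have rowQ i : \sum_(j in S) Q i j = 4.
  rewrite exchange_big -(outdeg4 i); apply: eq_bigr => v _ /=.
  rewrite -big_distrr /= -[RHS]muln1; congr (_ * _).
  by rewrite -[RHS](block_sum v (fun=> 1)); apply: eq_bigr => j _; rewrite muln1.
have QQ i j : \sum_(k in S) Q i k * Q k j = \sum_w e i w * Q w j.
  under eq_bigr do rewrite big_distrl.
  rewrite exchange_big; apply: eq_bigr => w _ /=.
  under eq_bigr do rewrite -mulnA.
  by rewrite -big_distrr /= (block_sum w (Q^~ j)) /Q equit.
have blockE i j : (f i == j) + Q i j + \sum_(k in S) Q i k * Q k j
    + (f (outlier i) == j) = \sum_v (f v == j).
  have -> : \sum_v (f v == j) = \sum_v (nwalks i v + (outlier i == v)) * (f v == j).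
    by apply: eq_bigr => v _; rewrite nwalks_outlier mul1n.
  under [RHS]eq_bigr do rewrite mulnDl.
  rewrite big_split /= sum_delta; congr (_ + _).
  under [RHS]eq_bigr do rewrite !mulnDl.
  rewrite !big_split /= sum_delta QQ; congr (_ + _).
  under [RHS]eq_bigr do rewrite big_distrl.
  rewrite exchange_big; apply: eq_bigr => w _; rewrite big_distrr /=.
  by apply: eq_bigr => v _; rewrite mulnA.
(* The column constants are the block sizes less [b]. *)
have [||k] := @trace_of_quotient {i | i \in S} (fun i j => Q (val i) (val j))
  (fun j => \sum_v (f v == val j) - b (val j)) 4 c c_gt0.
- by move=> i; rewrite -(big_sub S (Q (val i))) rowQ.
- move=> i j; rewrite -(big_sub S (fun k => Q (val i) k * Q k (val j))).
  rewrite -(inj_eq val_inj) -(blockE (val i)).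
  have /[!inE]/eqP fi := valP i; have /[!inE]/eqP fj := valP j.
  by have := outl _ _ fi fj; rewrite fi /=; lia.
rewrite -(big_sub S (fun i => Q i i)) card_sig => kE; exists k.
by rewrite -kE; congr (_ + _); apply: eq_card.
Qed.

Lemma outlier_nwalks0 u : nwalks u (outlier u) = 0.
Proof. by have := nwalks_outlier u (outlier u); rewrite eqxx addn1 => -[]. Qed.

Lemma outlier_neq u : outlier u != u.
Proof.
by apply/eqP => ou; have := outlier_nwalks0 u; rewrite ou /nwalks eqxx.
Qed.

Lemma outlier_nadj u : e u (outlier u) = false.
Proof. by have := outlier_nwalks0 u; rewrite /nwalks; case: (e _ _); lia. Qed.

Definition indeg v := \sum_w e w v.

Lemma indeg_balance u v :
  indeg v + \sum_w e u w * (outlier w == v) = 4 + e (outlier u) v.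
Proof.
have := @degree_balance [set: T] u v.
rewrite !inE => /(_ (fun _ _ _ _ _ _ _ => in_setT _) isT isT isT).
under eq_bigl do rewrite inE.
under [X in _ + X = _]eq_bigl do rewrite inE.
under [X in _ = X + _]eq_bigl do rewrite inE.
by rewrite outdeg4.
Qed.

Lemma sum_indeg : \sum_v indeg v = 88.
Proof.
rewrite exchange_big (eq_bigr (fun=> 4)) => [|u _]; last exact: outdeg4.
by rewrite sum_nat_const cardT22.
Qed.

Lemma column_count v :
  1 + indeg v + \sum_w e w v * indeg w + \sum_u (outlier u == v) = 22.
Proof.
have <- : \sum_u (nwalks u v + (outlier u == v)) = 22.
  by rewrite -cardT22 -sum1_card; apply: eq_bigr => u _; apply: nwalks_outlier.
rewrite /nwalks !big_split /=; congr (_ + _ + _ + _).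
  by rewrite -(sum_delta v (fun=> 1)); apply: eq_bigr => u; rewrite muln1 eq_sym.
rewrite exchange_big; apply: eq_bigr => w _; rewrite big_distrr /=.
by apply: eq_bigr => u _; rewrite mulnC.
Qed.

Lemma indeg_le5 v : indeg v <= 5.
Proof. by have := indeg_balance v v; case: (e _ _); lia. Qed.

Lemma indeg5_outlier u v : indeg v = 5 -> e (outlier u) v.
Proof. by have := indeg_balance u v; case: (e _ _) => //; lia. Qed.

(* If some in-degree is 5, then exactly two vertices are outliers, and they have
   the same out-neighbours; merging them gives a Moore digraph of degree 4 and
   diameter 2. *)
Lemma indeg_neq5 s : indeg s <> 5.
Proof.
move=> s5; pose F := [set w | indeg w == 5].
(* The 5 in-neighbours of [s] have in-degrees of sum at most 16. The other 17 vertices share at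
   least [72 = 17 * 4 + 4], and no in-degree exceeds 5. *)
have F4 : 4 <= #|F|.
  have Ns : \sum_w e w s * indeg w <= 16 by have := column_count s; lia.
  have cN : \sum_w ~~ e w s = 17.
    suff : \sum_w (e w s + ~~ e w s) = 22.
      by rewrite big_split /= -/(indeg s) s5; lia.
    by rewrite -cardT22 -sum1_card; apply: eq_bigr => w _; case: (e w s).
  have tot : \sum_w (e w s * indeg w + ~~ e w s * indeg w) = 88.
    rewrite -sum_indeg; apply: eq_bigr => w _.
    by case: (e w s); rewrite ?mul0n ?mul1n ?addn0.
  have : \sum_w ~~ e w s * indeg w <= \sum_w (~~ e w s * 4 + (indeg w == 5)).
    apply: leq_sum => w _; case: (e w s) => //=; have := indeg_le5 w.
    by case: eqP => [->|] //; lia.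
  rewrite big_split /= -big_distrl /= cN card_sum.
  by move: tot; rewrite big_split /=; lia.
have outN u w : e (outlier u) w = (w \in F).
  have sFN : F \subset [set w | e (outlier u) w].
    by apply/subsetP => x; rewrite !inE => /eqP; apply: indeg5_outlier.
  have /eqP -> : F == [set w | e (outlier u) w].
    by rewrite eqEcard sFN card_sum outdeg4.
  by rewrite inE.
have FF u w : w \in F -> e w (outlier u) = false.
  by rewrite -(outN u); apply: no_digon.
pose x0 := outlier s; pose x1 := outlier x0.
(* A third outlier would be within distance 2 of [x0]; but the arcs from [x0] lead into [F], which
   contains no outlier and has no arc to one. *)
have two u : outlier u = x0 \/ outlier u = x1.
  have [|] := eqVneq (outlier u) x0; first by left.
  have [|] := eqVneq (outlier u) x1; first by right.
  rewrite eq_sym => /negPf nx1; rewrite eq_sym => /negPf nx0.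
  have := nwalks_outlier x0 (outlier u); rewrite nx1 /nwalks nx0.
  have -> : e x0 (outlier u) = false.
    by rewrite outN -(outN u) loopless.
  rewrite big1 // => w _; case x0w: (e x0 w) => //.
  by rewrite FF // -(outN s).
pose f u := if u == x1 then x0 else u.
have x01 : (x0 == x1) = false by rewrite eq_sym (negPf (outlier_neq x0)).
have fx0 : f x0 = x0 by rewrite /f x01.
have ff u : f (f u) = f u by rewrite {2 3}/f; case: ifP => // ux1; rewrite /f ux1.
have [//|||k] := @quotient_trace f 1 (fun j => x0 == j) _ ff.
- move=> u j; apply: eq_bigr => v _; rewrite {1}/f.
  by case: eqP => // ->; rewrite /x1 /x0 !outN.
- move=> i j _ _; rewrite mul1n; congr (_ + _).
  by case: (two i) => ->; rewrite ?fx0 // /f eqxx.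
rewrite big1 => [|i /[!inE]/eqP fi]; last first.
  apply: big1 => v _; case: eqP => [fv|]; last by rewrite muln0.
  move: fv; rewrite /f; case: eqP => [-> <-|_ ->].
    by rewrite outlier_nadj.
  by rewrite loopless.
have -> : [set i | f i == i] = [set~ x1].
  by apply/setP => i; rewrite !inE /f; case: (eqVneq i x1) => [->|_]; rewrite ?x01 ?eqxx.
by rewrite cardsC1 cardT22; lia.
Qed.

Lemma indeg4 v : indeg v = 4.
Proof.
have le4 w : indeg w <= 4 by have := indeg_le5 w; have := @indeg_neq5 w; lia.
apply/eqP; rewrite eqn_leq le4 leqNgt; apply/negP => lt4.
have : \sum_w indeg w < \sum_(w : T) 4.
  rewrite (bigD1 v) //= [X in _ < X](bigD1 v) //= -addSn leq_add //.
  by apply: leq_sum => w _; apply: le4.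
by rewrite sum_indeg sum_nat_const cardT22.
Qed.

(** Each column of [1 + A + A^2] now sums to 21, which leaves room for just one [u] with a given
    outlier. *)
Lemma outlier_inj : injective outlier.
Proof.
move=> u v ouv; apply/eqP; apply: contraTT isT => uv.
have := column_count (outlier u).
rewrite indeg4 (eq_bigr (fun w => e w (outlier u) * 4)) => [|w _]; last by rewrite indeg4.
rewrite -big_distrl /= -/(indeg _) indeg4 (bigD1 u) //= (bigD1 v) 1?eq_sym //=.
by rewrite -ouv eqxx; lia.
Qed.

(** * The outlier permutation as an automorphism *)

Definition outlier_perm := perm outlier_inj.
Local Notation s := outlier_perm.

Lemma outlier_permE u : s u = outlier u. Proof. exact: permE. Qed.

(** With all in-degrees 4, the balance reads [A P = P A]. *)
Lemma outlier_auto u v : e (s u) (s v) = e u v.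
Proof.
rewrite !outlier_permE; have := indeg_balance u (outlier v).
rewrite indeg4 (bigD1 v) //= eqxx muln1 big1 ?addn0 => [|w /negPf wv].
  by move/addnI; do 2!case: (e _ _).
by rewrite (inj_eq outlier_inj) wv muln0.
Qed.

Lemma outlier_autoX n u v : e ((s ^+ n)%g u) ((s ^+ n)%g v) = e u v.
Proof.
elim: n => [|n IHn]; first by rewrite !perm1.
by rewrite expgSr !permM outlier_auto IHn.
Qed.

(** * Fixed subdigraphs of powers of the outlier automorphism *)

Definition fixed n : {set T} := [set x | (s ^+ n)%g x == x].

Lemma permX_outlier n x : (s ^+ n)%g (s x) = s ((s ^+ n)%g x).
Proof. by rewrite -!permM -expgSr -expgS. Qed.

Lemma fixed_outlier n x : (s x \in fixed n) = (x \in fixed n).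
Proof. by rewrite !inE permX_outlier (inj_eq perm_inj). Qed.

Lemma fixed_convex n x y z :
  x \in fixed n -> z \in fixed n -> e x y -> e y z -> y \in fixed n.
Proof.
rewrite !inE => /eqP xn /eqP zn exy eyz; apply/eqP.
apply: (@middle_unique x z) => //.
  by rewrite -[X in e X]xn outlier_autoX.
by rewrite -[X in e _ X]zn outlier_autoX.
Qed.

Definition fixed_deg n u := \sum_(w in fixed n) e u w.

(** The outlier terms of the balance cancel, since the automorphism preserves the fixed set. As [u]
    and [v] are independent, the subdigraph is regular. *)
Lemma fixed_balance n u v : u \in fixed n -> v \in fixed n ->
  \sum_(w in fixed n) e w v = fixed_deg n u.
Proof.
move=> uH vH; have := @degree_balance _ u v (@fixed_convex n) uH vH.
rewrite -outlier_permE fixed_outlier => /(_ uH).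
have [w0 vE] : exists w, v = s w by exists ((s^-1)%g v); rewrite permKV.
rewrite vE fixed_outlier in vH; rewrite vE outlier_auto (bigD1 w0 vH) /=.
rewrite [X in _ + X = _](bigD1 w0 vH) /= -outlier_permE eqxx muln1.
rewrite [X in _ + (_ + X) = _]big1 => [|w /andP[_ /negPf ww0]].
  by rewrite addn0 => /addIn.
by rewrite -outlier_permE (inj_eq perm_inj) ww0 muln0.
Qed.

Lemma fixed_deg_const n u v :
  u \in fixed n -> v \in fixed n -> fixed_deg n u = fixed_deg n v.
Proof. by move=> uH vH; rewrite -(fixed_balance uH vH) (fixed_balance vH vH). Qed.

Lemma card_fixed n u : u \in fixed n ->
  #|fixed n| = fixed_deg n u ^ 2 + fixed_deg n u + 2.
Proof.
move=> uH; set d := fixed_deg n u.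
have sum1 x : x \in fixed n -> \sum_(v in fixed n) (x == v) = 1.
  move=> xH; rewrite (bigD1 x) //= eqxx big1 // => v /andP[_ /negPf].
  by rewrite eq_sym => ->.
have ouH : outlier u \in fixed n by rewrite -outlier_permE fixed_outlier.
have -> : #|fixed n| = \sum_(v in fixed n) (nwalks u v + (outlier u == v)).
  by rewrite -sum1_card; apply: eq_bigr => v _; rewrite nwalks_outlier.
rewrite /nwalks !big_split /= !sum1 // -/(fixed_deg n u) -/d.
suff -> : \sum_(v in fixed n) \sum_w e u w * e w v = d ^ 2 by lia.
transitivity (\sum_(v in fixed n) \sum_(w in fixed n) e u w * e w v).
  apply: eq_bigr => v vH; rewrite [RHS]big_mkcond; apply: eq_bigr => w _.
  case: ifP => // /negP wH; case euw: (e u w) => //; case ewv: (e w v) => //.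
  by case: wH; apply: fixed_convex euw ewv.
rewrite exchange_big /= expnSr expn1 {1}/d /fixed_deg big_distrl /=.
apply: eq_bigr => w wH; rewrite -big_distrr /= -/(fixed_deg n w).
by rewrite (fixed_deg_const wH uH).
Qed.

Lemma fixed_prime_cases p (N := #[s]%g) (H := fixed (N %/ p)) :
    prime p -> p %| N ->
  H = set0 /\ p ^ logn p N %| 22 \/
  exists2 d, forall u, u \in H -> fixed_deg (N %/ p) u = d &
    [/\ d < 4, #|H| = d ^ 2 + d + 2, p %| 4 - d & p ^ logn p N %| 22 - #|H|].
Proof.
move=> p_pr pN; set m := N %/ p; have N_gt0 : 0 < N by apply: order_gt0.
have cardHC : p ^ logn p N %| 22 - #|H|.
  have -> : 22 - #|H| = #|~: H| by rewrite [RHS]cardsCs setCK cardT22.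
  apply: (@dvdn_card_of_porbits _ s) => x; rewrite !inE ?permX_outlier ?(inj_eq perm_inj) //.
  exact: pfactor_dvd_porbit.
have [H0|[u uH]] := set_0Vmem H; first by left; rewrite H0 cards0 in cardHC.
right; set d := fixed_deg m u; exists d; first by move=> v vH; apply: fixed_deg_const.
have cardH := card_fixed uH; rewrite -/d -/m -/H in cardH.
pose A := [set w | e u w] :\: H.
have dA : d + #|A| = 4.
  rewrite -(outdeg4 u) -(card_sum (e u)) -[RHS](cardsID H); congr (_ + _).
  rewrite /d /fixed_deg -sum1_card [RHS]big_mkcond [LHS]big_mkcond /=.
  by apply: eq_bigr => w _; rewrite !inE andbC; case: (_ == w); case: (e u w).
have pA : p %| #|A|.
  apply: (@dvdn_card_of_porbits _ (s ^+ m)%g) => x; rewrite !inE => /andP[xH eux].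
    rewrite (inj_eq perm_inj) xH /=; move: uH; rewrite inE => /eqP uH.
    by rewrite -uH outlier_autoX.
  have l_dvd : #|porbit (s ^+ m)%g x| %| p.
    by rewrite -permX_fixE -expgM divnK // expg_order perm1.
  have /(prime_nt_dvdP p_pr)/(_ l_dvd)-> // : #|porbit (s ^+ m)%g x| != 1.
  by rewrite -dvdn1 -permX_fixE expg1.
(* [d = 4] would make [s ^+ m] the identity, although [0 < m < N]. *)
have d_lt4 : d < 4.
  rewrite ltnNge; apply/negP => d_ge4.
  have : H = setT.
    apply/eqP; rewrite eqEcard subsetT cardsT cardT22 cardH.
    have -> : d = 4 by lia.
    by [].
  move=> HT; have m_gt0 : 0 < m by rewrite divn_gt0 ?prime_gt0 // dvdn_leq.
  suff /(dvdn_leq m_gt0) : N %| m by rewrite leqNgt ltn_Pdiv ?prime_gt1.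
  rewrite order_dvdn; apply/eqP/permP => x; rewrite perm1.
  by have /[!inE]/eqP : x \in H by rewrite HT inE.
split => //; have -> // : 4 - d = #|A| by lia.
Qed.

Lemma porbit_gt1 x : 1 < #|porbit s x|.
Proof.
have := outlier_neq x; rewrite -outlier_permE -{1}[s]expg1 permX_fixE dvdn1.
by have := card_porbit_neq0 s x; case: #|_| => [|[]].
Qed.

(** * Orbits of the outlier automorphism *)

Definition orbit_rep u := odflt u [pick v in porbit s u].
Local Notation f := orbit_rep.
Definition orbit_reps := [set i | f i == i].

Lemma orbit_rep_mem u : f u \in porbit s u.
Proof. by rewrite /f; case: pickP => //= _; apply: porbit_id. Qed.

Lemma porbit_rep u : porbit s (f u) = porbit s u.
Proof. by apply/eqP; rewrite eq_porbit_mem orbit_rep_mem. Qed.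

Lemma orbit_repE u v : (f u == f v) = (porbit s u == porbit s v).
Proof.
apply/eqP/eqP => [fuv|uv]; first by rewrite -porbit_rep fuv porbit_rep.
rewrite /f uv; case: pickP => // no; have := no v; by rewrite porbit_id.
Qed.

Lemma orbit_repK u : f (f u) = f u.
Proof. by apply/eqP; rewrite orbit_repE porbit_rep. Qed.

Lemma orbit_repX n u : f ((s ^+ n)%g u) = f u.
Proof. by apply/eqP; rewrite orbit_repE porbit_perm. Qed.

Lemma orbit_rep_eq i v : i \in orbit_reps -> (f v == i) = (v \in porbit s i).
Proof. by rewrite inE => /eqP {1}<-; rewrite orbit_repE eq_porbit_mem. Qed.

Lemma sum_card_porbit : \sum_(i in orbit_reps) #|porbit s i| = 22.
Proof.
rewrite -cardT22 -sum1_card [RHS](partition_big f [in orbit_reps]) /=; last first.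
  by move=> v _; rewrite inE orbit_repK.
apply: eq_bigr => i iS; rewrite -sum1_card; apply: eq_bigl => v.
by rewrite orbit_rep_eq.
Qed.

Definition inner_arcs i := \sum_v e i v * (f v == i).

(** Each vertex shares its orbit with its outlier, so [P] becomes the identity in the quotient;
    hence [c = 2]. *)
Lemma orbit_trace : exists k,
  2 * (\sum_(i in orbit_reps) inner_arcs i) + #|orbit_reps| = 9 * k.
Proof.
apply: (@quotient_trace f 2 (fun=> 0)) => //; first exact: orbit_repK.
  move=> u j; have /porbitP[n ->] := orbit_rep_mem u.
  rewrite (reindex_inj (@perm_inj _ (s ^+ n)%g)).
  by apply: eq_bigr => v _; rewrite outlier_autoX orbit_repX.
move=> i j fi _; rewrite -outlier_permE -{1}[s]expg1 orbit_repX fi; lia.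
Qed.

(* Two out-neighbours [s^a i] and [s^b i] of [i] would both precede [s^(a+b) i]. *)
Lemma inner_arcs_le1 i : i \in orbit_reps -> inner_arcs i <= 1.
Proof.
move=> iS; have -> : inner_arcs i = #|[set v | e i v && (v \in porbit s i)]|.
  rewrite card_sum; apply: eq_bigr => v _; rewrite orbit_rep_eq //.
  by case: (e i v); case: (_ \in _).
apply/card_le1_eqP => v v'; rewrite !inE.
move=> /andP[eiv /porbitP[a va]] /andP[eiv' /porbitP[b vb]].
apply: (@middle_unique i ((s ^+ b)%g v)) => //; first by rewrite vb outlier_autoX.
have -> : (s ^+ b)%g v = (s ^+ a)%g v' by rewrite va vb -!permM -!expgD addnC.
by rewrite va outlier_autoX.
Qed.

Lemma inner_arcs0 i : i \in orbit_reps -> #|porbit s i| = 2 -> inner_arcs i = 0.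
Proof.
move=> iS i2; apply: big1 => v _; rewrite orbit_rep_eq //.
have -> : porbit s i = [set i; s i].
  apply/eqP; rewrite eq_sym eqEcard i2 cards2 outlier_permE eq_sym outlier_neq andbT.
  apply/subsetP => x; rewrite !inE => /orP[]/eqP->; first exact: porbit_id.
  by rewrite -outlier_permE (mem_porbit s 1).
rewrite !inE outlier_permE; case: eqP => [->|_]; first by rewrite loopless.
by case: eqP => [->|_]; rewrite ?outlier_nadj // muln0.
Qed.

(** * Excluding the possible orders of the outlier permutation *)

Local Notation N := (#[s]%g).

(** The positive multiple of 9 in [orbit_trace] is at most three times the number of orbits. *)
Lemma orbit_reps_ge3 : 3 <= #|orbit_reps|.
Proof.
have [k kE] := orbit_trace.
have : \sum_(i in orbit_reps) inner_arcs i <= #|orbit_reps|.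
  by rewrite -sum1_card; apply: leq_sum => i /inner_arcs_le1.
suff : 0 < #|orbit_reps| by lia.
rewrite lt0n; apply/negP => /eqP/cards0_eq reps0.
by have := sum_card_porbit; rewrite reps0 big_set0.
Qed.

Lemma porbit_sub_fixed n x : x \in fixed n -> porbit s x \subset fixed n.
Proof.
move=> xH; apply/subsetP => _ /porbitP[k ->]; elim: k => [|k IHk].
  by rewrite perm1.
by rewrite expgSr permM fixed_outlier.
Qed.

Lemma pfactor_dvd_pfactor p k : prime p -> p ^ k %| N -> p ^ k %| p ^ logn p N.
Proof. by move=> p_pr; rewrite pfactor_dvdn ?order_gt0 //; apply: dvdn_exp2l. Qed.

Lemma prime_dvd_porbit p x : prime p -> p %| N -> x \notin fixed (N %/ p) ->
  p %| #|porbit s x|.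
Proof.
rewrite inE => p_pr pN xH; apply: dvdn_trans (pfactor_dvd_porbit p_pr pN xH).
by apply: (@pfactor_dvd_pfactor p 1).
Qed.

(** 11 divides no [4 - d] with [d < 4]; without fixed vertices all orbits have length at least 11,
    so there are at most two. *)
Lemma order_coprime11 : ~~ (11 %| N).
Proof.
apply/negP => dvd11.
case: (fixed_prime_cases (isT : prime 11) dvd11) => [[H0 _]|[d _ [d_lt4 _]]]; last first.
  by case: d d_lt4 => [|[|[|[]]]].
have : \sum_(i in orbit_reps) 11 <= 22.
  rewrite -sum_card_porbit; apply: leq_sum => i _; apply: dvdn_leq.
    by rewrite lt0n card_porbit_neq0.
  by apply: prime_dvd_porbit; rewrite // H0 inE.
by rewrite sum_nat_const; have := orbit_reps_ge3; lia.
Qed.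

(* A 1-regular fixed subdigraph is a directed 4-cycle, along which the outlier
   permutation steps backwards; so its vertices form one orbit of length 4. *)
Lemma fixed_deg1_porbit n u : u \in fixed n ->
    (forall v, v \in fixed n -> fixed_deg n v = 1) -> #|fixed n| = 4 ->
  exists w, porbit s w = fixed n.
Proof.
set H := fixed n => uH deg1 cardH.
have next a : a \in H -> exists2 b, b \in H & e a b.
  move=> aH; have : fixed_deg n a != 0 by rewrite deg1.
  by rewrite sum_nat_eq0 => /forall_inPn[b bH eab]; exists b => //; move: eab; case: (e a b).
have [v vH uv] := next u uH; have [w wH vw] := next v vH.
have [x xH wx] := next w wH.
(* The outlier of [a] is the fourth vertex, and [s b] can be neither [b], nor its out-neighbour [c],
   nor [s a]. *)
have four a b c : a \in H -> b \in H -> c \in H -> e a b -> e b c ->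
    H = [set a; b; c; s a] /\ s b = a.
  move=> aH bH cH ab bc.
  have sa_a : s a == a = false by rewrite outlier_permE (negPf (outlier_neq a)).
  have sa_b : s a == b = false.
    by apply/eqP => sab; have := outlier_nadj a; rewrite -outlier_permE sab ab.
  have sa_c : s a == c = false.
    apply/eqP => sac; have := outlier_nwalks0 a; rewrite -outlier_permE sac.
    by move/eqP; rewrite /nwalks (bigD1 b) //= ab bc !addn_eq0 /= !andbF.
  have ab' : a == b = false by apply/eqP => E; rewrite E loopless in ab.
  have bc' : b == c = false by apply/eqP => E; rewrite E loopless in bc.
  have ac' : a == c = false by apply/eqP => E; rewrite -E (no_digon ab) in bc.
  have HE : H = [set a; b; c; s a].
    apply/esym/eqP; rewrite eqEcard !subUset !sub1set fixed_outlier aH bH cH cardH.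
    rewrite setUC cardsU1 !inE sa_a sa_b sa_c /= setUC cardsU1 !inE.
    by rewrite eq_sym ac' [c == b]eq_sym bc' cards2 ab'.
  split=> //; have : s b \in H by rewrite fixed_outlier.
  rewrite HE !inE (inj_eq perm_inj) [b == a]eq_sym ab' orbF.
  rewrite !outlier_permE (negPf (outlier_neq b)) orbF => /orP[/eqP //|/eqP sbc].
  by have := outlier_nadj b; rewrite sbc bc.
have [HE sv] := four u v w uH vH wH uv vw.
have [_ sw] := four v w x vH wH xH vw wx.
exists w; apply/eqP; rewrite eqEsubset porbit_sub_fixed //= -/H HE.
have sX y : y \in porbit s w -> s y \in porbit s w.
  by move=> /porbitP[j ->]; rewrite -permM -expgSr mem_porbit.
have pw := porbit_id s w; have pv := sX _ pw; rewrite sw in pv.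
have pu := sX _ pv; rewrite sv in pu; have pz := sX _ pu.
by apply/subsetP => y; rewrite !inE -!orbA => /or4P[]/eqP->.
Qed.

(** Otherwise the power of order 3 fixes exactly one orbit, of length 4. Then 4 divides [N], and the
    power of order 2 fixes just two vertices. Their orbits are too short to be that 4-orbit or to
    have length divisible by 3. *)
Lemma order_coprime3 : ~~ (3 %| N).
Proof.
apply/negP => dvd3.
case: (fixed_prime_cases (isT : prime 3) dvd3) => [[_ d22]|[d dH [d_lt4 cH d4 _]]].
  suff : 3 %| 22 by [].
  by apply: dvdn_trans d22; apply: (@pfactor_dvd_pfactor 3 1).
have {d_lt4 d4} d1 : d = 1 by case: d d_lt4 d4 {dH cH} => [|[|[|[]]]].
rewrite {d}d1 in dH cH.
have [u uH] : exists u, u \in fixed (N %/ 3) by apply/card_gt0P; rewrite cH.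
have [w wE] := fixed_deg1_porbit uH dH cH.
have dvd4 : 4 %| N by have := dvdn_porbit_order s w; rewrite wE cH.
have dvd2 : 2 %| N by apply: dvdn_trans dvd4.
have v4 : 4 %| 2 ^ logn 2 N by apply: (@pfactor_dvd_pfactor 2 2).
case: (fixed_prime_cases (isT : prime 2) dvd2) => [[_ d22]|[d _ [d_lt4 cH2 d4 d20]]].
  by have := dvdn_trans v4 d22.
have d0 : d = 0.
  have := dvdn_trans v4 d20; rewrite cH2.
  by case: d d_lt4 d4 {cH2 d20} => [|[|[|[]]]].
have {}cH2 : #|fixed (N %/ 2)| = 2 by rewrite cH2 d0.
have [y yH] : exists y, y \in fixed (N %/ 2) by apply/card_gt0P; rewrite cH2.
have ly : #|porbit s y| <= 2 by rewrite -cH2 subset_leq_card // porbit_sub_fixed.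
have [yH3|yH3] := boolP (y \in fixed (N %/ 3)).
  move: ly; suff -> : porbit s y = fixed (N %/ 3) by rewrite cH.
  by apply/eqP; rewrite -wE eq_porbit_mem wE.
have /dvdn_leq := prime_dvd_porbit (isT : prime 3) dvd3 yH3.
by rewrite lt0n card_porbit_neq0 leqNgt => /(_ isT); rewrite ltnS ly.
Qed.

Lemma no_excess_one : False.
Proof.
(* A prime factor of [N] divides 22 or some [4 - d] with [d < 4]. *)
have order2 : N = 2 ^ logn 2 N.
  rewrite -p_part part_pnat_id //; apply/pnatP; first exact: order_gt0.
  move=> p p_pr pN; suff : p \in [:: 2; 3; 11].
    rewrite !inE => /or3P[/eqP-> //|/eqP p3|/eqP p11].
      by have := order_coprime3; rewrite -p3 pN.
    by have := order_coprime11; rewrite -p11 pN.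
  case: (fixed_prime_cases p_pr pN) => [[_ d22]|[d _ [d_lt4 _ d4 _]]].
    have : p %| 22 by apply: dvdn_trans d22; apply: (@pfactor_dvd_pfactor p 1).
    rewrite dvdn_divisors // !inE => /or4P[]/eqP p_eq //; move: p_pr; by rewrite p_eq.
  have : p <= 4 by apply: leq_trans (dvdn_leq _ d4) _; lia.
  by case: (p) p_pr => [|[|[|[|[|[]]]]]].
have [i0 _] : exists i, i \in orbit_reps.
  by apply/card_gt0P; have := orbit_reps_ge3; lia.
have dvd2 : 2 %| N.
  rewrite order2; case: (logn 2 N) order2 => [N1|a _]; last by rewrite expnS dvdn_mulr.
  have := dvdn_porbit_order s i0; have := porbit_gt1 i0.
  by rewrite N1 dvdn1; case: #|_| => [|[]].
have [k kE] := orbit_trace; have cE := sum_card_porbit.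
(* If 4 divides [N], it divides neither 22 nor [22 - 8], so [d = 0]; then the 2-part of [N] divides
   [22 - 2 = 20]. *)
have [N2|[N4 cH]] : N = 2 \/ N = 4 /\ #|fixed 2| = 2.
  have a_gt0 : 0 < logn 2 N by rewrite logn_gt0 mem_primes order_gt0.
  have [a1|a_neq1] := eqVneq (logn 2 N) 1; first by left; rewrite order2 a1.
  have v4 : 4 %| 2 ^ logn 2 N by apply: (@dvdn_exp2l 2 2); lia.
  right.
  case: (fixed_prime_cases (isT : prime 2) dvd2) => [[_ d22]|[d _ [d_lt4 cH d4 d20]]].
    by have := dvdn_trans v4 d22.
  have d0 : d = 0.
    have := dvdn_trans v4 d20; rewrite cH.
    by case: d d_lt4 d4 {cH d20} => [|[|[|[]]]].
  have {}cH : #|fixed (N %/ 2)| = 2 by rewrite cH d0.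
  rewrite cH in d20; suff N4 : N = 4 by rewrite N4 in cH *.
  have a_lt3 : logn 2 N < 3.
    by rewrite ltnNge; apply/negP => /(dvdn_exp2l 2)/dvdn_trans/(_ d20).
  by rewrite order2; have -> : logn 2 N = 2 by lia.
(* There are 11 orbits of length 2 and the trace is 0, but 9 does not divide 11. *)
- have l2 i : #|porbit s i| = 2.
    have := dvdn_leq _ (dvdn_porbit_order s i); rewrite N2 => /(_ isT).
    by have := porbit_gt1 i; lia.
  move: cE kE; rewrite (eq_bigr (fun=> 2)) // sum_nat_const.
  by rewrite big1 => [|i iS]; [lia | rewrite inner_arcs0].
(* Orbits have length 2 inside [fixed 2] and 4 outside. As [fixed 2] has two vertices, there is one
   2-orbit and five 4-orbits, so the trace is at most 5; but [2 * tr + 6] divisible by 9 needs at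
   least 6. *)
- have lE i : #|porbit s i| + (i \in fixed 2) + (i \in fixed 2) = 4.
    rewrite inE permX_fixE; have := dvdn_porbit_order s i; rewrite N4.
    by have := porbit_gt1 i; case: #|_| => [|[|[|[|[|n]]]]] // _ /dvdn_leq; lia.
  have : \sum_(i in orbit_reps) (#|porbit s i| + (i \in fixed 2) + (i \in fixed 2))
      = #|orbit_reps| * 4.
    by rewrite (eq_bigr (fun=> 4)) // sum_nat_const.
  have : \sum_(i in orbit_reps) (inner_arcs i + (i \in fixed 2)) <= #|orbit_reps|.
    rewrite -sum1_card; apply: leq_sum => i iS; have := lE i.
    case: (i \in fixed 2) => li; last by rewrite addn0 inner_arcs_le1.
    by rewrite inner_arcs0 //; lia.
  have : \sum_(i in orbit_reps) (i \in fixed 2 : nat) <= 2.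
    rewrite -[leqRHS]cH -[leqRHS]sum1_card big_mkcond [leqRHS]big_mkcond.
    by apply: leq_sum => i _; case: (i \in fixed 2); case: (i \in orbit_reps).
  by rewrite !big_split /= cE; lia.
Qed.
End ExcessOne.

Theorem theorem6 (T : finType) (e : rel T) : ~ excess_one_digraph 4 2 e.
Proof.
case=> geo [outdeg_ge4 _]; rewrite /moore_bound !big_ord_recl big_ord0 => cardT.
exact: no_excess_one geo outdeg_ge4 cardT.
Qed.
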